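(* Let $n\ge 1$, let $W^{(1)},\dots,W^{(n)}$ and $V$ be normed spaces, let $\mathcal{M}\colon W^{(1)}\times\dots\times W^{(n)}\to V$ be multilinear and continuous, i.e. there is $C>0$ with $\|\mathcal{M}(a^{(1)},\dots,a^{(n)})\|\le C\prod_{j=1}^n\|a^{(j)}\|$ for all $a^{(j)}\in W^{(j)}$. Let $w^{(j)}\in W^{(j)}$, put $v:=\mathcal{M}(w^{(1)},\dots,w^{(n)})$, and for each $j\in\{1,\dots,n\}$ let $(w^{(j)}_N)_{N\ge1}$ be a family in $W^{(j)}$, indexed by real $N\ge 1$, such that for some $\beta_j>0$, $\gamma_j>0$ $$\|w^{(j)}-w^{(j)}_N\|\lesssim_N N^{-\beta_j},\qquad \mathrm{Work}(w^{(j)}_N)\lesssim_N N^{\gamma_j},$$ where $\mathrm{Work}$ is a nonnegative cost which is subadditive and multiplicative under $\mathcal{M}$ (see context). Let $\mathcal{S}_L(v)$, $L\in\{1,2,\dots\}$, be Smolyak's algorithm (see context), and set $$\rho:=\max_{1\le j\le n}\gamma_j/\beta_j,\qquad n_0:=|\{j:\gamma_j/\beta_j=\rho\}|.$$ Then for all sufficiently small $\epsilon>0$ one can choose $L=L(\epsilon)$ such that $$\|\mathcal{S}_L(v)-v\|\lesssim_\epsilon \epsilon\qquad\text{and}\qquad \mathrm{Work}(\mathcal{S}_L(v))\lesssim_\epsilon \epsilon^{-\rho}|\log\epsilon|^{(n_0-1)(1+\rho)} .$$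
   Context: Notation: $A\lesssim_x B$ means $A\le cB$ with a constant $c$ independent of $x$. Smolyak's algorithm: for $j\in\{1,\dots,n\}$ and $l\in\{1,2,\dots\}$ let $t_j:=1/(\gamma_j+\beta_j)$, $N^{(j)}_l:=\exp(t_j l)$, and $$\Delta^{(j)}_l:=w^{(j)}_{N^{(j)}_l}-w^{(j)}_{N^{(j)}_{l-1}},\quad\text{with the convention } w^{(j)}_{N^{(j)}_0}:=0 .$$ For $\boldsymbol{l}\in\{1,2,\dots\}^n$ let $\Delta_{\boldsymbol{l}}:=\mathcal{M}(\Delta^{(1)}_{l_1},\dots,\Delta^{(n)}_{l_n})$, $|\boldsymbol{l}|_1:=l_1+\dots+l_n$, and $$\mathcal{S}_L(v):=\sum_{|\boldsymbol{l}|_1\le L}\Delta_{\boldsymbol{l}}\in V .$$ Work model: $\mathrm{Work}$ assigns a nonnegative number to expressions (representations of elements) such that $\mathrm{Work}(\mathcal{M}(a^{(1)},\dots,a^{(n)})+\mathcal{M}(b^{(1)},\dots,b^{(n)}))\le \mathrm{Work}(\mathcal{M}(a^{(1)},\dots,a^{(n)}))+\mathrm{Work}(\mathcal{M}(b^{(1)},\dots,b^{(n)}))$ (and likewise for longer finite sums), and $\mathrm{Work}(\mathcal{M}(a^{(1)},\dots,a^{(n)}))=\prod_{j=1}^n\mathrm{Work}(a^{(j)})$. The work of a difference of two approximations of the same input is at most the sum of their works (and the convention term $0$ costs nothing), so $\mathrm{Work}(\Delta^{(j)}_l)\le \mathrm{Work}(w^{(j)}_{N^{(j)}_l})+\mathrm{Work}(w^{(j)}_{N^{(j)}_{l-1}})$.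 $\mathrm{Work}(\mathcal{S}_L(v))$ is the work of the expression $\sum_{|\boldsymbol{l}|_1\le L}\mathcal{M}(\Delta^{(1)}_{l_1},\dots,\Delta^{(n)}_{l_n})$. *)

(* Defs.v *)
From HB Require Import structures.
From mathcomp Require Import all_boot all_order all_algebra.
From mathcomp Require Import all_classical all_reals all_analysis.

Set Implicit Arguments.
Unset Strict Implicit.
Unset Printing Implicit Defensive.

Import Order.TTheory GRing.Theory Num.Theory.
Import numFieldNormedType.Exports.

Local Open Scope ring_scope.

(* [dfwith a j x] is [a] with its [j]-th component replaced by [x : W j]. *)
Definition multilinear (R : realType) (n : nat) (W : 'I_n -> normedModType R)
    (V : normedModType R) (M : (forall j, W j) -> V) : Prop :=
  forall (a : forall j, W j) (j : 'I_n), linear (fun x : W j => M (dfwith a j x)).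

Definition multilinear_bounded (R : realType) (n : nat)
    (W : 'I_n -> normedModType R) (V : normedModType R)
    (M : (forall j, W j) -> V) : Prop :=
  exists C : R, 0 < C /\
    forall a : forall j, W j, `|M a| <= C * \prod_(j < n) `|a j|.

(* N_l = exp(t l) with t = 1/(gamma + beta) *)
Definition smolyak_param (R : realType) (gamma beta : R) (l : nat) : R :=
  expR ((gamma + beta)^-1 * l%:R).

(* At l = 0 the convention is w_(N_0) = 0, although N_0 = 1 is a legal value
   of the parameter. *)
Definition smolyak_level (R : realType) (W : normedModType R)
    (gamma beta : R) (wN : R -> W) (l : nat) : W :=
  if l is 0%N then 0 else wN (smolyak_param gamma beta l).

Definition smolyak_diff (R : realType) (W : normedModType R)
    (gamma beta : R) (wN : R -> W) (l : nat) : W :=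
  smolyak_level gamma beta wN l - smolyak_level gamma beta wN l.-1.

(* The l in {1,2,...}^n with |l|_1 <= L: every component of such an l is at
   most L, so that the codomain 'I_L.+1 loses nothing. *)
Definition smolyak_indices (n L : nat) : {set {ffun 'I_n -> 'I_L.+1}} :=
  [set l : {ffun 'I_n -> 'I_L.+1}
     | [forall j, (0 < l j)%N] && (\sum_(j < n) l j <= L)%N].

Definition smolyak (R : realType) (n : nat) (W : 'I_n -> normedModType R)
    (V : normedModType R) (M : (forall j, W j) -> V) (gamma beta : 'I_n -> R)
    (wN : forall j, R -> W j) (L : nat) : V :=
  \sum_(l in smolyak_indices n L)
    M (fun j => smolyak_diff (gamma j) (beta j) (wN j) (l j)).

(* Work is a function of expressions, not of the elements they denote, hence
   the following formal syntax. [Approx N] stands for w_N; which of the n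
   inputs it approximates is determined by the slot in which it occurs. *)
Inductive approx_expr (R : Type) : Type :=
| Zero
| Approx of R.
Arguments Zero {R}.

Inductive factor_expr (R : Type) : Type :=
| Approximation of approx_expr R
| Difference of approx_expr R & approx_expr R.

(* The formal sum M(a_1) + ... + M(a_k) of products, a_i being the n-tuple of
   arguments of the i-th product; [:: a] is the single product M(a). *)
Definition sum_expr (R : Type) (n : nat) : Type := seq ('I_n -> factor_expr R).

Definition eval_approx (R : realType) (W : normedModType R) (wN : R -> W)
    (e : approx_expr R) : W :=
  match e with Zero => 0 | Approx N => wN N end.

Definition eval_factor (R : realType) (W : normedModType R) (wN : R -> W)
    (e : factor_expr R) : W :=
  match e with
  | Approximation a => eval_approx wN a
  | Difference a b => eval_approx wN a - eval_approx wN b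
  end.

Definition eval_sum (R : realType) (n : nat) (W : 'I_n -> normedModType R)
    (V : normedModType R) (M : (forall j, W j) -> V)
    (wN : forall j, R -> W j) (s : sum_expr R n) : V :=
  \sum_(a <- s) M (fun j => eval_factor (wN j) (a j)).

Record work_model (R : realType) (n : nat) : Type := WorkModel {
  work_factor : 'I_n -> factor_expr R -> R;
  work_sum : sum_expr R n -> R;
  work_factor_ge0 : forall j e, 0 <= work_factor j e;
  work_sum_ge0 : forall s, 0 <= work_sum s;
  work_zero : forall j, work_factor j (Approximation Zero) = 0;
  work_difference : forall j a b,
    work_factor j (Difference a b) <=
      work_factor j (Approximation a) + work_factor j (Approximation b);
  work_product : forall a : 'I_n -> factor_expr R,
    work_sum [:: a] = \prod_(j < n) work_factor j (a j);
  work_subadditive : forall s : sum_expr R n, s <> [::] ->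
    work_sum s <= \sum_(a <- s) work_sum [:: a]
}.

Definition smolyak_level_expr (R : realType) (gamma beta : R) (l : nat) :
    approx_expr R :=
  if l is 0%N then Zero else Approx (smolyak_param gamma beta l).

Definition smolyak_diff_expr (R : realType) (gamma beta : R) (l : nat) :
    factor_expr R :=
  Difference (smolyak_level_expr gamma beta l)
             (smolyak_level_expr gamma beta l.-1).

Definition smolyak_expr (R : realType) (n : nat) (gamma beta : 'I_n -> R)
    (L : nat) : sum_expr R n :=
  [seq (fun j => smolyak_diff_expr (gamma j) (beta j) (l j))
     | l : {ffun 'I_n -> 'I_L.+1} <- enum (smolyak_indices n L)].

Lemma eval_smolyak_expr (R : realType) (n : nat) (W : 'I_n -> normedModType R)
    (V : normedModType R) (M : (forall j, W j) -> V) (gamma beta : 'I_n -> R)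
    (wN : forall j, R -> W j) (L : nat) :
  eval_sum M wN (smolyak_expr gamma beta L) = smolyak M gamma beta wN L.
Proof.
rewrite /eval_sum /smolyak /smolyak_expr big_map big_enum /=.
apply: eq_bigr => l _; congr M; apply: functional_extensionality_dep => j.
rewrite /smolyak_diff /smolyak_diff_expr /=.
by case: (nat_of_ord (l j)) => [|[|k]].
Qed.

(* The ratios are positive and n > 0 wherever this is used, so that the
   initial value 0 does not affect the maximum. *)
Definition work_rate (R : realType) (n : nat) (gamma beta : 'I_n -> R) : R :=
  \big[Num.max/0]_(j < n) (gamma j / beta j).

Definition work_rate_mult (R : realType) (n : nat) (gamma beta : 'I_n -> R) :
    nat :=
  #|[pred j : 'I_n | gamma j / beta j == work_rate gamma beta]|.

(* Main.v *)
Require Import Defs.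
From HB Require Import structures.
From mathcomp Require Import all_boot all_order all_algebra.
From mathcomp Require Import all_classical all_reals all_analysis.
From mathcomp Require Import ring.

Set Implicit Arguments.
Unset Strict Implicit.
Unset Printing Implicit Defensive.

Import Order.TTheory GRing.Theory Num.Theory.
Import numFieldNormedType.Exports.

Local Open Scope ring_scope.

(** Write b_j = beta_j / (gamma_j + beta_j) and g_j = gamma_j / (gamma_j + beta_j),
so that b_j + g_j = 1.  With N_l = exp(l / (gamma_j + beta_j)) the differences
Delta^(j)_l have norm O(exp(-b_j l)) and work O(exp(g_j l)).  A factor j is
called critical when gamma_j / beta_j = rho; these are the n0 factors where b_j
is minimal, equal to b = 1 / (1 + rho), and equivalently where g_j is maximal,
equal to g = rho / (1 + rho).

Error.  To keep all sums finite, each w^(j) is written as the sum of L + 1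
pieces, the differences Delta^(j)_1, ..., Delta^(j)_L and the remainder
w^(j) - w^(j)_(N_L).  The remainder has norm O(exp(-b_j (L + 1))), so it behaves
like one more difference, of degree L + 1.  Expanding M w multilinearly
([multilinear_expand]) and removing S_L leaves only products of total degree
greater than L ([smolyak_error_le]).

Counting.  Both the error and the work are now sums over multi-indices l of
h(|l|) prod_j x_j^(l_j) with 0 <= x_j <= 1 and x_j = 1 exactly at the critical
factors, where h is a truncated geometric sequence: exp(-b m) for m > L, or
exp(g m) for m <= L.  Trading one critical coordinate of l for the total degree
|l| decouples the sum into (sum_m h(m)) times one sum per remaining coordinate.
Those sums are bounded at noncritical coordinates and at most L + 1 at the
n0 - 1 remaining critical ones ([sum_ffun_degree_expn_le]).  This gives
error = O(exp(-b L) L^(n0-1)) and work = O(exp(g L) L^(n0-1)).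

Balancing.  With E = |log eps|, the choice L ~ (1 + rho) (E + (n0 - 1) log E)
makes exp(-b L) about eps E^-(n0-1), which compensates L^(n0-1) = O(E^(n0-1)) in
the error, and makes exp(g L) about eps^-rho E^((n0-1) rho)
([balanced_levelP]). *)

(** * Sums over multi-indices *)

Lemma sum_geometric_le (R : realType) (x : R) (N : nat) :
  0 <= x -> x < 1 -> \sum_(i < N) x ^+ i <= (1 - x)^-1.
Proof.
move=> x0 x1; have d0 : 0 < 1 - x by rewrite subr_gt0.
rewrite -[leRHS]mul1r ler_pdivlMr // mulrC -opprB mulNr -subrX1 opprB.
by rewrite lerBlDr lerDl exprn_ge0.
Qed.

(** The map sending l to the pair of its total degree and l with coordinate j0
erased is injective, so the left-hand sum is part of a sum over all such pairs,
and the latter factorizes. *)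
Lemma sum_ffun_degree_le (R : realType) (n K : nat) (j0 : 'I_n)
    (lam : 'I_K.+1 -> nat) (h : nat -> R) (H : R)
    (q : 'I_n -> 'I_K.+1 -> R) :
  injective lam -> (forall m, 0 <= h m) ->
  (forall N, \sum_(m < N) h m <= H) -> (forall j k, 0 <= q j k) ->
  \sum_(l : {ffun 'I_n -> 'I_K.+1})
     h (\sum_(j < n) lam (l j))%N * \prod_(j < n | j != j0) q j (l j)
  <= H * \prod_(j < n | j != j0) \sum_k q j k.
Proof.
move=> laminj h0 hH q0.
pose deg (l : {ffun 'I_n -> 'I_K.+1}) := (\sum_(j < n) lam (l j))%N.
pose N := \max_l deg l.
have degN l : (deg l < N.+1)%N by rewrite ltnS; exact: leq_bigmax.
pose phi l : 'I_N.+1 * {ffun 'I_n -> 'I_K.+1} :=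
  (inord (deg l), [ffun j => if j == j0 then ord0 else l j]).
have phi_inj : injective phi.
  move=> l l' [e1 e2].
  have ne j : j != j0 -> l j = l' j.
    by move=> /negPf jj0; move/ffunP: e2 => /(_ j); rewrite !ffunE jj0.
  apply/ffunP => j; have [->|] := eqVneq j j0; last exact: ne.
  apply: laminj; move/(congr1 val): e1; rewrite /= !inordK // /deg.
  rewrite (bigD1 j0) //= [in RHS](bigD1 j0) //=.
  rewrite (eq_bigr (fun j => lam (l' j))) => [/addIn//|i /ne -> //].
(* Erased multi-indices are those vanishing at j0; the factor q' j0 selects them
   and makes the product run over all coordinates. *)
pose q' j k := if j == j0 then (k == ord0)%:R else q j k.
have q'0 j k : 0 <= q' j k by rewrite /q'; case: ifP.
pose F (u : 'I_N.+1 * {ffun 'I_n -> 'I_K.+1}) :=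
  h u.1 * \prod_(j < n) q' j (u.2 j).
have F0 u : 0 <= F u by rewrite mulr_ge0 ?prodr_ge0.
have FE l : h (deg l) * \prod_(j < n | j != j0) q j (l j) = F (phi l).
  rewrite /F /= inordK //; congr (_ * _).
  rewrite [RHS](bigD1 j0) //= ffunE /q' !eqxx mul1r.
  by apply: eq_bigr => j /negPf jj0; rewrite jj0 ffunE jj0.
under eq_bigr do rewrite FE.
rewrite -(big_imset F (A := predT)); last by move=> ? ? _ _; exact: phi_inj.
apply: (@le_trans _ _ (\sum_u F u)).
  by rewrite [leRHS](bigID (mem [set phi l | l in predT])) /= lerDl sumr_ge0.
rewrite -(pair_bigA _ (fun m l => F (m, l))) /= /F /=.
under eq_bigr do rewrite -mulr_sumr.
rewrite -mulr_suml -(bigA_distr_bigA q') (bigD1 j0) //=.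
rewrite [X in _ * (X * _)](bigD1 ord0) //= [X in _ + X]big1; last first.
  by move=> k /negPf k0; rewrite /q' eqxx k0.
rewrite /q' !eqxx addr0 mul1r.
under [X in _ * X]eq_bigr => j /negPf jj0 do under eq_bigr do rewrite jj0.
apply: ler_wpM2r; last exact: hH.
by rewrite prodr_ge0 // => j _; rewrite sumr_ge0.
Qed.

(** A factor with x j < 1 contributes a convergent geometric series, whereas one
with x j = 1 contributes the number K + 1 of its levels; the coordinate j0 is
paid for by the sum of h.  The labelling lam is arbitrary so that the constant A
serves both the plain levels and the levels completed by a remainder. *)
Lemma sum_ffun_degree_expn_le (R : realType) (n : nat) (j0 : 'I_n)
    (x : 'I_n -> R) :
  (forall j, 0 <= x j <= 1) -> x j0 = 1 ->
  exists2 A, 0 <= A & forall (K : nat) (lam : 'I_K.+1 -> nat) (h : nat -> R)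
      (H : R),
    injective lam -> (forall k : 'I_K.+1, (k <= lam k)%N) ->
    (forall m, 0 <= h m) -> (forall N, \sum_(m < N) h m <= H) ->
    \sum_(l : {ffun 'I_n -> 'I_K.+1})
       h (\sum_(j < n) lam (l j))%N * \prod_(j < n) x j ^+ lam (l j)
    <= A * H * K.+1%:R ^+ #|[pred j | x j == 1]|.-1.
Proof.
move=> x01 xj0.
pose a j := if x j == 1 then 1 else (1 - x j)^-1.
have a0 j : 0 <= a j.
  rewrite /a; case: ifP => // _; rewrite invr_ge0 subr_ge0.
  by case/andP: (x01 j).
exists (\prod_(j < n | j != j0) a j) => [|K lam h H laminj lamge h0 hH].
  by rewrite prodr_ge0.
have H0 : 0 <= H by have := hH 0%N; rewrite big_ord0.
have x0 j : 0 <= x j by case/andP: (x01 j).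
have prodE (l : {ffun 'I_n -> 'I_K.+1}) : \prod_(j < n) x j ^+ lam (l j) =
    \prod_(j < n | j != j0) x j ^+ lam (l j).
  by rewrite (bigD1 j0) //= xj0 expr1n mul1r.
under eq_bigr => l _ do rewrite prodE.
apply: le_trans (sum_ffun_degree_le j0 (q := fun j k => x j ^+ lam k)
  laminj h0 hH _) _; first by move=> j k; rewrite exprn_ge0.
rewrite [_ * H]mulrC -mulrA ler_wpM2l //.
have -> : (K.+1%:R : R) ^+ #|[pred j | x j == 1]|.-1 =
    \prod_(j < n | j != j0) (if x j == 1 then K.+1%:R else 1).
  rewrite -big_mkcondr /= prodr_const; congr (_ ^+ _).
  have xj01 : j0 \in [pred j | x j == 1] by apply/eqP.
  rewrite (cardD1 j0 [pred j | x j == 1]) xj01 /=; apply: eq_card => j.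
  by rewrite !inE.
rewrite -big_split /=; apply: ler_prod => j _; apply/andP; split.
  by rewrite sumr_ge0 // => k _; rewrite exprn_ge0.
rewrite /a; case: eqVneq => [->|xj1].
  rewrite mul1r; under eq_bigr do rewrite expr1n.
  by rewrite sumr_const card_ord.
rewrite mulr1; have xlt1 : x j < 1.
  by rewrite lt_neqAle xj1; case/andP: (x01 j).
apply: le_trans (sum_geometric_le K.+1 (x0 j) xlt1).
apply: ler_sum => k _; apply: ler_wiXn2l => //; exact: ltW.
Qed.

(** Factoring expR (- b j0) to the power of the total degree leaves the ratios
x j = expR (b j0 - b j) <= 1, and the tail of a convergent geometric series is
comparable to its first term. *)
Lemma sum_ffun_exp_far_le (R : realType) (n : nat) (b : 'I_n -> R)
    (j0 : 'I_n) :
  0 < b j0 -> (forall j, b j0 <= b j) ->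
  exists2 A, 0 <= A & forall (L : nat) (lam : 'I_L.+1 -> nat),
    injective lam -> (forall k : 'I_L.+1, (k <= lam k)%N) ->
    \sum_(l : {ffun 'I_n -> 'I_L.+1} | (L < \sum_(j < n) lam (l j))%N)
       \prod_(j < n) expR (- b j * (lam (l j))%:R)
    <= A * expR (- b j0 * L%:R) * L.+1%:R ^+ #|[pred j | b j == b j0]|.-1.
Proof.
move=> b0 bmin; pose x j := expR (b j0 - b j).
have x01 j : 0 <= x j <= 1 by rewrite expR_ge0 -expR0 ler_expR subr_le0 bmin.
have xj0 : x j0 = 1 by rewrite /x subrr expR0.
have [A A0 hA] := sum_ffun_degree_expn_le x01 xj0.
pose y := expR (- b j0); have y0 : 0 <= y := expR_ge0 _.
have y1 : y < 1 by rewrite expR_lt1 oppr_lt0.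
exists (A * (1 - y)^-1) => [|L lam laminj lamge].
  by rewrite mulr_ge0 // invr_ge0 subr_ge0 ltW.
pose h m := if (L < m)%N then y ^+ m else 0.
have h0 m : 0 <= h m by rewrite /h; case: ifP => // _; rewrite exprn_ge0.
have hH N : \sum_(m < N) h m <= (1 - y)^-1 * y ^+ L.
  rewrite -(big_mkord xpredT h).
  have [NL|/ltnW LN] := leqP N L.
    rewrite big_nat_cond big1 => [|m].
      by rewrite mulr_ge0 ?exprn_ge0 // invr_ge0 subr_ge0 ltW.
    by rewrite andbT /= /h => mN; rewrite ltnNge (ltnW (leq_trans mN NL)).
  rewrite (big_cat_nat (leq0n L) LN) //= big_nat_cond big1 ?add0r => [|m]; last first.
    by rewrite andbT /= /h => mL; rewrite ltnNge (ltnW mL).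
  rewrite -{1}[L]add0n big_addn big_mkord.
  apply: (@le_trans _ _ (\sum_(i < N - L) y ^+ i * y ^+ L)).
    apply: ler_sum => i _; rewrite /h; case: ifP => _; first by rewrite exprD.
    by rewrite mulr_ge0 ?exprn_ge0.
  by rewrite -mulr_suml ler_wpM2r ?exprn_ge0 ?sum_geometric_le.
have -> : #|[pred j | b j == b j0]| = #|[pred j | x j == 1]|.
  by apply: eq_card => j; rewrite !inE -expR0 (inj_eq (@expR_inj R)) subr_eq0 eq_sym.
rewrite [expR (- b j0 * _)]expRM_natr -/y -(mulrA A).
apply: le_trans (hA L lam h _ laminj lamge h0 hH); rewrite big_mkcond /=.
apply: ler_sum => l _; rewrite /h; case: ifP => _; last by rewrite mul0r.
rewrite expr_sum -big_split /=.
rewrite (_ : \prod_(_ < _) _ = \prod_(j < n) (y * x j) ^+ lam (l j)).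
  by under [leRHS]eq_bigr do rewrite -exprMn.
by apply: eq_bigr => j _; rewrite /y /x -expRD addrA addNr add0r expRM_natr.
Qed.

(** Here expR (g j0) to the power of the total degree grows, and a geometric sum
is comparable to its last term. *)
Lemma sum_ffun_exp_near_le (R : realType) (n : nat) (g : 'I_n -> R)
    (j0 : 'I_n) :
  0 < g j0 -> (forall j, g j <= g j0) ->
  exists2 A, 0 <= A & forall L : nat,
    \sum_(l : {ffun 'I_n -> 'I_L.+1} | (\sum_(j < n) l j <= L)%N)
       \prod_(j < n) expR (g j * (l j)%:R)
    <= A * expR (g j0 * L%:R) * L.+1%:R ^+ #|[pred j | g j == g j0]|.-1.
Proof.
move=> g0 gmax; pose x j := expR (g j - g j0).
have x01 j : 0 <= x j <= 1 by rewrite expR_ge0 -expR0 ler_expR subr_le0 gmax.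
have xj0 : x j0 = 1 by rewrite /x subrr expR0.
have [A A0 hA] := sum_ffun_degree_expn_le x01 xj0.
pose y := expR (g j0); have y0 : 0 < y := expR_gt0 _.
have y1 : y^-1 < 1 by rewrite /y -expRN expR_lt1 oppr_lt0.
have yV0 : 0 <= y^-1 by rewrite invr_ge0 ltW.
exists (A * (1 - y^-1)^-1) => [|L].
  by rewrite mulr_ge0 // invr_ge0 subr_ge0 ltW.
pose h m := if (m <= L)%N then y ^+ m else 0.
have h0 m : 0 <= h m by rewrite /h; case: ifP => // _; rewrite exprn_ge0 // ltW.
have hH N : \sum_(m < N) h m <= (1 - y^-1)^-1 * y ^+ L.
  apply: (@le_trans _ _ (\sum_(m < L.+1) h m)).
    rewrite -!(big_mkord xpredT h).
    have [NL|/ltnW LN] := leqP N L.+1.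
      by rewrite (big_cat_nat (leq0n N) NL) //= lerDl sumr_ge0.
    rewrite (big_cat_nat (leq0n L.+1) LN) //= [X in _ + X]big_nat_cond [X in _ + X]big1.
      by rewrite addr0.
    by move=> m; rewrite andbT /h => /andP[Lm _]; rewrite leqNgt Lm.
  rewrite (reindex_inj rev_ord_inj) /=.
  apply: (@le_trans _ _ (\sum_(i < L.+1) y^-1 ^+ i * y ^+ L)).
    apply: ler_sum => i _; rewrite /h subSS leq_subr.
    have iL : (i <= L)%N by rewrite -ltnS.
    have -> : y ^+ L = y ^+ i * y ^+ (L - i) by rewrite -exprD subnKC.
    rewrite mulrA -exprMn mulVf ?expr1n ?mul1r //.
    by rewrite gt_eqF.
  by rewrite -mulr_suml ler_wpM2r ?exprn_ge0 ?sum_geometric_le // ltW.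
have -> : #|[pred j | g j == g j0]| = #|[pred j | x j == 1]|.
  by apply: eq_card => j; rewrite !inE -expR0 (inj_eq (@expR_inj R)) subr_eq0.
rewrite [expR (g j0 * _)]expRM_natr -/y -(mulrA A).
apply: le_trans (hA L _ h _ val_inj (fun k => leqnn _) h0 hH); rewrite big_mkcond /=.
apply: ler_sum => l _; rewrite /h; case: ifP => _; last by rewrite mul0r.
rewrite expr_sum -big_split /=.
rewrite (_ : \prod_(_ < _) _ = \prod_(j < n) (y * x j) ^+ l j).
  by under [leRHS]eq_bigr do rewrite -exprMn.
by apply: eq_bigr => j _; rewrite /y /x -expRD addrC subrK expRM_natr.
Qed.

(** * Expansion of a multilinear map *)

(** A multi-index supported on m :: s is one supported on s together with its
value at m: the induction step of the expansion below. *)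
Lemma sum_ffun_supported_cons (n K : nat) (V : zmodType) (m : 'I_n) (s : seq 'I_n)
    (F : {ffun 'I_n -> 'I_K.+1} -> V) :
  m \notin s ->
  let supported s (l : {ffun 'I_n -> 'I_K.+1}) :=
    [forall j, (j \notin s) ==> (l j == ord0)] in
  \sum_(l | supported (m :: s) l) F l =
  \sum_k \sum_(l | supported s l) F [ffun j => if j == m then k else l j].
Proof.
move=> ms supported.
rewrite (partition_big (fun l : {ffun _} => l m) xpredT) //=.
apply: eq_bigr => k _.
rewrite (reindex_onto
  (fun l : {ffun 'I_n -> 'I_K.+1} => [ffun j => if j == m then k else l j])
  (fun l : {ffun 'I_n -> 'I_K.+1} =>
     [ffun j => if j == m then ord0 else l j])) /=; last first.
  move=> l /andP[_ /eqP lm]; apply/ffunP => j; rewrite !ffunE.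
  by case: eqVneq => // ->.
apply: eq_bigl => l; rewrite ffunE eqxx eqxx andbT.
apply/andP/forallP => [[/forallP sup /eqP lE] j|sup].
  apply/implyP => js; have [->|jm] := eqVneq j m.
    by rewrite -lE ffunE eqxx.
  have := sup j; rewrite inE (negPf jm) /= (negPf js) ffunE (negPf jm).
  by [].
split.
  apply/forallP => j; rewrite inE ffunE; case: (j == m) => //=.
apply/eqP/ffunP => j; rewrite !ffunE; case: eqVneq => // ->.
by apply/esym/eqP; move/implyP: (sup m); apply.
Qed.

Lemma multilinear_expand (R : realType) (n K : nat)
    (W : 'I_n -> normedModType R) (V : normedModType R)
    (M : (forall j, W j) -> V) (x : forall j, 'I_K.+1 -> W j) :
  multilinear M ->
  M (fun j => \sum_k x j k) =
  \sum_(l : {ffun 'I_n -> 'I_K.+1}) M (fun j => x j (l j)).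
Proof.
move=> Mlin.
(* The coordinates are expanded one at a time; the remaining arguments a are
   arbitrary, which lets the induction hypothesis absorb a chosen term. *)
have key (s : seq 'I_n) (a : forall j, W j) : uniq s ->
  M (fun j => if j \in s then \sum_k x j k else a j) =
  \sum_(l : {ffun 'I_n -> 'I_K.+1}
           | [forall j, (j \notin s) ==> (l j == ord0)])
    M (fun j => if j \in s then x j (l j) else a j).
  elim: s a => [|m s IH] a /=.
    move=> _; rewrite (big_pred1 [ffun=> ord0]) // => l.
    apply/forallP/eqP => [l0|-> j]; last by rewrite ffunE eqxx.
    by apply/ffunP => j; rewrite ffunE; apply/eqP/l0.
  case/andP => ms us; rewrite sum_ffun_supported_cons //=.
  pose f (u : W m) :=
    M (dfwith (fun j => if j \in s then \sum_k x j k else a j) m u).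
  pose fL : {linear W m -> V} :=
    HB.pack f (GRing.isLinear.Build R (W m) V _ f (Mlin _ m)).
  rewrite (_ : M _ = fL (\sum_k x m k)); last first.
    rewrite /= /f; congr M; apply: functional_extensionality_dep => j.
    case: dfwithP => [|i mi]; first by rewrite inE eqxx.
    by rewrite inE eq_sym (negPf mi).
  rewrite linear_sum; apply: eq_bigr => k _ /=.
  rewrite /f (_ : dfwith _ _ _ = fun j => if j \in s then \sum_k x j k
                                   else dfwith a m (x m k) j); last first.
    apply: functional_extensionality_dep => j.
    case: dfwithP => [|i mi]; first by rewrite (negPf ms) dfwithin.
    by rewrite dfwithout.
  rewrite IH //; apply: eq_bigr => l _; congr M.
  apply: functional_extensionality_dep => j; rewrite ffunE inE.
  have [->|jm] := eqVneq j m; first by rewrite (negPf ms) dfwithin.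
  by rewrite dfwithout // eq_sym.
have := key (enum 'I_n) (fun=> 0) (enum_uniq _).
rewrite (_ : (fun j => if j \in enum 'I_n then _ else _) =
  fun j => \sum_k x j k); last first.
  by apply: functional_extensionality_dep => j; rewrite mem_enum.
move=> ->; apply: eq_big => [l|l _].
  by apply/forallP => j; rewrite mem_enum.
by congr M; apply: functional_extensionality_dep => j; rewrite mem_enum.
Qed.

(** * Error of Smolyak's algorithm *)
Lemma smolyak_param_powR (R : realType) (gamma beta a : R) (l : nat) :
  smolyak_param gamma beta l `^ a = expR (a / (gamma + beta) * l%:R).
Proof. by rewrite /smolyak_param -expRM; congr expR; ring. Qed.

Lemma smolyak_param_ge1 (R : realType) (gamma beta : R) (l : nat) :
  0 < gamma -> 0 < beta -> 1 <= smolyak_param gamma beta l.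
Proof.
move=> g0 b0; rewrite -expR0 ler_expR mulr_ge0 // invr_ge0.
by rewrite addr_ge0 // ltW.
Qed.

Lemma smolyak_level_error_le (R : realType) (W : normedModType R)
    (gamma beta : R) (w : W) (wN : R -> W) :
  0 < gamma -> 0 < beta ->
  (exists c : R, forall N, 1 <= N -> `|w - wN N| <= c * N `^ (- beta)) ->
  exists2 D, 0 <= D & forall l : nat,
    `|w - smolyak_level gamma beta wN l|
      <= D * expR (- (beta / (gamma + beta)) * l%:R).
Proof.
move=> g0 b0 [c hc].
have c0 : 0 <= c.
  by have := hc 1 (lexx _); rewrite powR1 mulr1; exact: le_trans.
(* The summand `|w| accounts for level 0, where the approximation is 0. *)
exists (c + `|w|) => [|[|l]]; first by rewrite addr_ge0.
  by rewrite /= subr0 mulr0 expR0 mulr1 lerDr.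
apply: le_trans (hc _ (smolyak_param_ge1 _ g0 b0)) _.
by rewrite smolyak_param_powR mulNr ler_wpM2r ?expR_ge0 // lerDl.
Qed.

(** The differences of levels 1, ..., L together with the remainder after level L,
which is placed at the index 0.  In this way the pieces of w are indexed by the
same type 'I_L.+1 as the levels in [smolyak], whose multi-indices all have
positive components. *)
Definition completed_diff (R : realType) (W : normedModType R)
    (gamma beta : R) (w : W) (wN : R -> W) (L : nat) (k : 'I_L.+1) : W :=
  if k == ord0 then w - smolyak_level gamma beta wN L
  else smolyak_diff gamma beta wN k.

(** The remainder has the decay of a difference of level L + 1. *)
Definition completed_degree (L : nat) (k : 'I_L.+1) : nat :=
  if k == ord0 then L.+1 else k.

Lemma completed_degree_inj (L : nat) : injective (@completed_degree L).
Proof.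
move=> k k'; rewrite /completed_degree.
have [->|_] := eqVneq k ord0; have [->|_] := eqVneq k' ord0 => //.
- by move=> e; have := ltn_ord k'; rewrite -e ltnn.
- by move=> e; have := ltn_ord k; rewrite e ltnn.
- exact: val_inj.
Qed.

Lemma leq_completed_degree (L : nat) (k : 'I_L.+1) :
  (k <= completed_degree k)%N.
Proof. by rewrite /completed_degree; case: ifP => // _; exact: ltnW. Qed.

Lemma sum_completed_diff (R : realType) (W : normedModType R)
    (gamma beta : R) (w : W) (wN : R -> W) (L : nat) :
  \sum_(k < L.+1) completed_diff gamma beta w wN k = w.
Proof.
rewrite big_ord_recl {1}/completed_diff eqxx.
rewrite (eq_bigr (fun i : 'I_L => smolyak_level gamma beta wN i.+1 -
  smolyak_level gamma beta wN i)) //.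
rewrite -(big_mkord xpredT (fun i => smolyak_level gamma beta wN i.+1 -
  smolyak_level gamma beta wN i)).
by rewrite telescope_sumr //= subr0 subrK.
Qed.

Lemma completed_diff_le (R : realType) (W : normedModType R)
    (gamma beta : R) (w : W) (wN : R -> W) :
  0 < gamma -> 0 < beta ->
  (exists c : R, forall N, 1 <= N -> `|w - wN N| <= c * N `^ (- beta)) ->
  exists2 D, 0 <= D & forall (L : nat) (k : 'I_L.+1),
    `|completed_diff gamma beta w wN k|
      <= D * expR (- (beta / (gamma + beta)) * (completed_degree k)%:R).
Proof.
move=> g0 b0 /(smolyak_level_error_le g0 b0)[D D0 hD].
set b := beta / _; have prevE (k : nat) :
    D * expR (- b * k%:R) = D * expR b * expR (- b * k.+1%:R).
  by rewrite -mulrA -expRD; congr (_ * expR _); rewrite -[k.+1]addn1 natrD; ring.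
exists (D * (1 + expR b)) => [|L k].
  by rewrite mulr_ge0 // addr_ge0 ?expR_ge0.
rewrite /completed_diff /completed_degree mulrDr mulr1.
case: eqVneq => [_|k0].
  apply: le_trans (hD L) _; rewrite -/b prevE ler_wpM2r ?expR_ge0 //.
  by rewrite lerDr.
have kS : (val k).-1.+1 = val k by rewrite prednK // lt0n.
apply: le_trans (ler_distD w _ _) _; rewrite distrC mulrDl.
apply: lerD; first exact: hD.
by have := hD (val k).-1; rewrite -/b prevE kS.
Qed.

(** In the expansion of M w into products of completed differences, the indices
outside [smolyak_indices] have total completed degree at least L + 1: either a
remainder occurs, or the degree bound fails. *)
Lemma smolyak_error_le (R : realType) (n : nat)
    (W : 'I_n -> normedModType R) (V : normedModType R)
    (M : (forall j, W j) -> V) (w : forall j, W j) (wN : forall j, R -> W j)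
    (beta gamma : 'I_n -> R) (j0 : 'I_n) :
  let b j := beta j / (gamma j + beta j) in
  multilinear M -> multilinear_bounded M ->
  (forall j, 0 < beta j) -> (forall j, 0 < gamma j) ->
  (forall j, exists c : R, forall N : R, 1 <= N ->
     `|w j - wN j N| <= c * N `^ (- beta j)) ->
  (forall j, b j0 <= b j) ->
  exists2 A, 0 <= A & forall L : nat,
    `|smolyak M gamma beta wN L - M w|
      <= A * expR (- b j0 * L%:R) * L.+1%:R ^+ #|[pred j | b j == b j0]|.-1.
Proof.
move=> b Mlin [C [C0 hC]] beta0 gamma0 approx bmin.
have b0 : 0 < b j0 by rewrite divr_gt0 ?addr_gt0.
have [A A0 hA] := sum_ffun_exp_far_le b0 bmin.
have /choice[D hD] j : exists D : R, 0 <= D /\ forall (L : nat) (k : 'I_L.+1),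
    `|completed_diff (gamma j) (beta j) (w j) (wN j) k|
      <= D * expR (- b j * (completed_degree k)%:R).
  by have [D] := completed_diff_le (gamma0 j) (beta0 j) (approx j); exists D.
have D0 : 0 <= C * \prod_(j < n) D j.
  by rewrite mulr_ge0 ?(ltW C0) // prodr_ge0 // => j _; case: (hD j).
exists (C * (\prod_(j < n) D j) * A) => [|L]; first by rewrite mulr_ge0.
pose x j (k : 'I_L.+1) := completed_diff (gamma j) (beta j) (w j) (wN j) k.
have -> : M w = \sum_(l : {ffun 'I_n -> 'I_L.+1}) M (fun j => x j (l j)).
  rewrite -multilinear_expand //; congr M.
  by apply: functional_extensionality_dep => j; rewrite sum_completed_diff.
rewrite (bigID (mem (smolyak_indices n L))) /= /smolyak.
rewrite [X in _ - (X + _)](_ : _ = smolyak M gamma beta wN L); last first.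
  apply: eq_bigr => l; rewrite inE => /andP[/forallP l0 _]; congr M.
  apply: functional_extensionality_dep => j.
  by rewrite /x /completed_diff -val_eqE /= gtn_eqF.
rewrite opprD addrA subrr add0r normrN.
apply: le_trans (ler_norm_sum _ _ _) _; rewrite -[X in _ <= X * _]mulrA -[leRHS]mulrA.
have hA' := hA L _ (@completed_degree_inj L) (@leq_completed_degree L).
apply: le_trans (ler_wpM2l D0 hA'); rewrite mulr_sumr.
rewrite big_mkcond [leRHS]big_mkcond /=; apply: ler_sum => l _.
case: ifPn => [lnot|_]; last first.
  by case: ifP => // _; rewrite mulr_ge0 // prodr_ge0 // => j _; exact: expR_ge0.
rewrite ifT; last first.
  move: lnot; rewrite inE negb_and negb_forall => /orP[/existsP[j]|].
    rewrite lt0n negbK => lj; rewrite (bigD1 j) //= /completed_degree.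
    by rewrite -val_eqE lj ltnS leq_addr.
  rewrite -ltnNge => /leq_trans; apply; apply: leq_sum => j _.
  exact: leq_completed_degree.
apply: le_trans (hC _) _; rewrite -mulrA ler_wpM2l ?(ltW C0) // -big_split /=.
by apply: ler_prod => j _; rewrite normr_ge0; case: (hD j) => _ ->.
Qed.

(** * Work of Smolyak's algorithm *)
Lemma smolyak_diff_work_le (R : realType) (n : nat) (Work : work_model R n)
    (j : 'I_n) (gamma beta : R) :
  0 < gamma -> 0 < beta ->
  (exists c : R, forall N : R, 1 <= N ->
     work_factor Work j (Approximation (Approx N)) <= c * N `^ gamma) ->
  exists2 D, 0 <= D & forall l : nat,
    work_factor Work j (smolyak_diff_expr gamma beta l)
      <= D * expR (gamma / (gamma + beta) * l%:R).
Proof.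
move=> g0 b0 [c hc].
have c0 : 0 <= c.
  have := hc 1 (lexx _); rewrite powR1 mulr1; apply: le_trans.
  exact: work_factor_ge0.
have level l : work_factor Work j
    (Approximation (smolyak_level_expr gamma beta l))
      <= c * expR (gamma / (gamma + beta) * l%:R).
  case: l => [|l] /=; first by rewrite work_zero mulr_ge0 ?expR_ge0.
  by rewrite -smolyak_param_powR; apply: hc; exact: smolyak_param_ge1.
exists (c + c) => [|l]; first by rewrite addr_ge0.
apply: le_trans (work_difference _ _ _ _) _; rewrite mulrDl.
apply: lerD => //; apply: le_trans (level _) _; rewrite ler_wpM2l // ler_expR.
rewrite ler_wpM2l ?ler_nat ?leq_pred // divr_ge0 ?addr_ge0 ?ltW //.
Qed.

(** For n <= L the algorithm has at least one summand, so that subadditivity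
applies; the work of an empty sum is not controlled by the work model. *)
Lemma smolyak_work_le (R : realType) (n : nat) (Work : work_model R n)
    (beta gamma : 'I_n -> R) (j0 : 'I_n) :
  let g j := gamma j / (gamma j + beta j) in
  (forall j, 0 < beta j) -> (forall j, 0 < gamma j) ->
  (forall j, exists c : R, forall N : R, 1 <= N ->
     work_factor Work j (Approximation (Approx N)) <= c * N `^ gamma j) ->
  (forall j, g j <= g j0) ->
  exists2 A, 0 <= A & forall L : nat, (n <= L)%N ->
    work_sum Work (smolyak_expr gamma beta L)
      <= A * expR (g j0 * L%:R) * L.+1%:R ^+ #|[pred j | g j == g j0]|.-1.
Proof.
move=> g beta0 gamma0 cost gmax.
have g0 : 0 < g j0 by rewrite divr_gt0 ?addr_gt0.
have [A A0 hA] := sum_ffun_exp_near_le g0 gmax.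
have /choice[D hD] j : exists D : R, 0 <= D /\ forall l : nat,
    work_factor Work j (smolyak_diff_expr (gamma j) (beta j) l)
      <= D * expR (g j * l%:R).
  by have [D] := smolyak_diff_work_le (gamma0 j) (beta0 j) (cost j); exists D.
have D0 : 0 <= \prod_(j < n) D j by rewrite prodr_ge0 // => j _; case: (hD j).
exists ((\prod_(j < n) D j) * A) => [|L nL]; first by rewrite mulr_ge0.
have ne : smolyak_expr gamma beta L <> [::].
  have L0 : (1 < L.+1)%N.
    by rewrite ltnS (leq_trans _ nL) // (leq_trans _ (ltn_ord j0)).
  pose l1 : {ffun 'I_n -> 'I_L.+1} := [ffun=> Ordinal L0].
  have : l1 \in enum (smolyak_indices n L).
    rewrite mem_enum inE; apply/andP; split.
      by apply/forallP => j; rewrite ffunE.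
    by under eq_bigr do rewrite ffunE; rewrite sum_nat_const card_ord muln1.
  by rewrite /smolyak_expr; case: (enum _).
apply: le_trans (work_subadditive _ ne) _.
rewrite /smolyak_expr big_map big_enum /=.
rewrite -[X in _ <= X * _]mulrA -[leRHS]mulrA.
apply: le_trans (ler_wpM2l D0 (hA L)); rewrite mulr_sumr.
rewrite big_mkcond [leRHS]big_mkcond /=; apply: ler_sum => l _.
case: ifPn => [|_]; last first.
  by case: ifP => // _; rewrite mulr_ge0 // prodr_ge0 // => j _; exact: expR_ge0.
rewrite inE => /andP[_ ->]; rewrite work_product -big_split /=.
by apply: ler_prod => j _; rewrite work_factor_ge0; case: (hD j) => _ ->.
Qed.

(** * Choice of the level *)

(** The integer just above (1 + rho) (E + p log E): the first term makes
exp(- L / (1 + rho)) as small as exp(- E), the second makes it beat the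
polynomial factor L^p. *)
Definition balanced_level (R : realType) (rho : R) (p : nat) (E : R) : nat :=
  (Num.truncn ((1 + rho) * (E + p%:R * ln E))).+1.

Lemma balanced_levelP (R : realType) (rho : R) (p : nat) :
  0 < rho ->
  exists2 kappa, 0 <= kappa & forall E : R, 1 <= E ->
    let L := balanced_level rho p E in
    [/\ E <= L%:R,
        expR (- (1 + rho)^-1 * L%:R) * L.+1%:R ^+ p <= kappa * expR (- E)
      & expR (rho / (1 + rho) * L%:R) * L.+1%:R ^+ p
          <= kappa * (expR (rho * E) * E `^ (p%:R * (1 + rho)))].
Proof.
move=> rho0; have rho1 : 0 < 1 + rho by rewrite addr_gt0.
(* L + 1 <= (1 + rho) (E + p ln E) + 2, where ln E <= E and 1 <= E. *)
pose K : R := (1 + rho) * (1 + p%:R) + 2.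
have K0 : 0 <= K by rewrite addr_ge0 // mulr_ge0 ?addr_ge0 // ltW.
exists (expR (rho / (1 + rho)) * K ^+ p) => [|E E1 L].
  by rewrite mulr_ge0 ?expR_ge0 ?exprn_ge0.
have E0 : 0 < E := lt_le_trans ltr01 E1.
have lnE0 : 0 <= ln E := ln_ge0 E1.
pose Y := E + p%:R * ln E; pose X := (1 + rho) * Y.
have EY : E <= Y by rewrite lerDl mulr_ge0.
have Y0 : 0 <= Y := le_trans (ltW E0) EY.
have YX : Y <= X by rewrite /X mulrDl mul1r lerDl mulr_ge0 // ltW.
have XL : X <= L%:R by rewrite ltW // truncnS_gt.
have LX : L%:R <= X + 1.
  rewrite -natr1 lerD2r; have /andP[] // := truncn_itv (le_trans Y0 YX).
have LK : L.+1%:R <= K * E.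
  rewrite -natr1; apply: (@le_trans _ _ (X + 2)).
    by rewrite -[2]/(1 + 1 : R) addrA lerD2r.
  rewrite /K mulrDl; apply: lerD; last by rewrite ler_peMr.
  rewrite /X -mulrA ler_wpM2l ?(ltW rho1) // /Y mulrDl mul1r lerD2l.
  by rewrite ler_wpM2l // ltW // ln_sublinear.
have LKp : L.+1%:R ^+ p <= K ^+ p * E ^+ p.
  by rewrite -exprMn lerXn2r ?nnegrE // mulr_ge0 // ltW.
have EpE : E ^+ p = expR (p%:R * ln E) by rewrite expRM_natl lnK // posrE.
have c1 : 1 <= expR (rho / (1 + rho)).
  by rewrite ltW // expR_gt1 divr_gt0.
split; first exact: le_trans EY (le_trans YX XL).
- have XE : expR (- (1 + rho)^-1 * X) = expR (- E) * (E ^+ p)^-1.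
    by rewrite EpE -expRN -expRD /X mulNr mulKf ?gt_eqF // opprD.
  have le1 : expR (- (1 + rho)^-1 * L%:R) <= expR (- E) * (E ^+ p)^-1.
    by rewrite -XE ler_expR ler_nM2l // oppr_lt0 invr_gt0.
  apply: le_trans (ler_pM (expR_ge0 _) (exprn_ge0 _ (ler0n _ _)) le1 LKp) _.
  rewrite [leLHS](_ : _ = K ^+ p * expR (- E)); last first.
    by rewrite mulrACA mulVf ?mulr1 1?mulrC // expf_neq0 // gt_eqF.
  by rewrite ler_wpM2r ?expR_ge0 // ler_peMl // exprn_ge0.
- have le1 : expR (rho / (1 + rho) * L%:R) <=
      expR (rho / (1 + rho)) * expR (rho * Y).
    rewrite -expRD ler_expR [leRHS](_ : _ = rho / (1 + rho) * (X + 1)).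
      by rewrite ler_wpM2l // divr_ge0 ?(ltW rho0) ?(ltW rho1).
    by rewrite /X; field; rewrite gt_eqF.
  apply: le_trans (ler_pM (expR_ge0 _) (exprn_ge0 _ (ler0n _ _)) le1 LKp) _.
  rewrite le_eqVlt; apply/orP; left; apply/eqP.
  rewrite /powR gt_eqF // EpE.
  have -> : expR (p%:R * (1 + rho) * ln E) =
      expR (p%:R * ln E) * expR (rho * (p%:R * ln E)).
    by rewrite -expRD; congr expR; ring.
  by rewrite /Y mulrDr expRD; ring.
Qed.

(** Since b / (g + b) = 1 / (1 + g / b), the slowest decay is that of the
largest ratio. *)
Lemma ler_ratio_share (R : realType) (b g b' g' : R) :
  0 < b -> 0 < g -> 0 < b' -> 0 < g' ->
  (b' / (g' + b') <= b / (g + b)) = (g / b <= g' / b').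
Proof.
move=> b0 g0 b'0 g'0.
rewrite ler_pdivrMr ?addr_gt0 // mulrAC ler_pdivlMr ?addr_gt0 //.
rewrite ler_pdivrMr // mulrAC ler_pdivlMr // !mulrDr.
by rewrite [b' * b]mulrC lerD2r [b' * g]mulrC [b * g']mulrC.
Qed.

(** * Accuracy and work at the balanced level *)
Theorem theorem2p1 (R : realType) (n : nat) (n_gt0 : (0 < n)%N)
    (W : 'I_n -> normedModType R) (V : normedModType R)
    (M : (forall j, W j) -> V)
    (M_multilinear : multilinear M) (M_bounded : multilinear_bounded M)
    (w : forall j, W j) (wN : forall j, R -> W j)
    (Work : work_model R n) (beta gamma : 'I_n -> R)
    (beta_gt0 : forall j, 0 < beta j) (gamma_gt0 : forall j, 0 < gamma j)
    (approximation : forall j, exists c : R, forall N : R, 1 <= N ->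
       `|w j - wN j N| <= c * N `^ (- beta j))
    (cost : forall j, exists c : R, forall N : R, 1 <= N ->
       work_factor Work j (Approximation (Approx N)) <= c * N `^ gamma j) :
  let rho := work_rate gamma beta in
  let n0 := work_rate_mult gamma beta in
  exists (eps0 : R) (L : R -> nat) (c1 c2 : R),
    0 < eps0 /\
    forall eps : R, 0 < eps -> eps < eps0 ->
      [/\ (1 <= L eps)%N,
          `|smolyak M gamma beta wN (L eps) - M w| <= c1 * eps
        & work_sum Work (smolyak_expr gamma beta (L eps)) <=
            c2 * (eps `^ (- rho)
                  * `|ln eps| `^ ((n0%:R - 1) * (1 + rho)))].
Proof.
move=> rho n0.
have ratio0 j : 0 < gamma j / beta j by rewrite divr_gt0.
have [j0 _ rhoE] := eq_bigmax (x := 0) (Ordinal n_gt0) xpredT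
  (fun j => gamma j / beta j) isT (fun j _ => ltW (ratio0 j)).
rewrite -/(work_rate gamma beta) -/rho in rhoE.
have rho0 : 0 < rho by rewrite rhoE.
have rho_max j : gamma j / beta j <= gamma j0 / beta j0.
  by rewrite -rhoE; exact: (le_bigmax 0 (fun j => gamma j / beta j)).
pose b j := beta j / (gamma j + beta j).
pose g j := gamma j / (gamma j + beta j).
have sum0 j : gamma j + beta j != 0 by rewrite gt_eqF ?addr_gt0.
have bg j : g j = 1 - b j by rewrite /g /b; field.
have b_min j : b j0 <= b j by rewrite ler_ratio_share.
have g_max j : g j <= g j0 by rewrite !bg lerD2l lerN2.
have bE : b j0 = (1 + rho)^-1.
  by rewrite rhoE /b; field; rewrite !gt_eqF ?addr_gt0.
have gE : g j0 = rho / (1 + rho).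
  by rewrite bg bE; field; rewrite gt_eqF // addr_gt0.
have card_b : #|[pred j | b j == b j0]| = n0.
  apply: eq_card => j; rewrite !inE -/rho rhoE.
  by rewrite !eq_le !ler_ratio_share // andbC.
have card_g : #|[pred j | g j == g j0]| = n0.
  rewrite -card_b; apply: eq_card => j.
  by rewrite !inE !bg (inj_eq (addrI _)) eqr_opp.
have n0_gt0 : (0 < n0)%N.
  by rewrite -card_b; apply/card_gt0P; exists j0; rewrite inE.
have [A A0 hA] := smolyak_error_le M_multilinear M_bounded beta_gt0 gamma_gt0
  approximation b_min.
have [B B0 hB] := smolyak_work_le beta_gt0 gamma_gt0 cost g_max.
rewrite -/(b _) -/b card_b bE in hA; rewrite -/(g _) -/g card_g gE in hB.
have [kappa kappa0 hL] := balanced_levelP n0.-1 rho0.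
(* eps < exp(- n) forces n <= |log eps| <= L. *)
exists (expR (- n%:R)), (fun eps => balanced_level rho n0.-1 (- ln eps)).
exists (A * kappa), (B * kappa); split; first exact: expR_gt0.
move=> eps eps_gt0 eps_lt; set E := - ln eps.
have nE : n%:R <= E.
  by rewrite lerNr -[X in _ <= X]expRK ler_ln ?posrE ?expR_gt0 // ltW.
have E1 : 1 <= E by apply: le_trans nE; rewrite ler1n.
have [EL err wrk] := hL E E1; split => //.
- apply: le_trans (hA _) _; rewrite -!mulrA ler_wpM2l //.
  by rewrite -[X in kappa * X]lnK ?posrE // -[ln eps]opprK.
- have nL : (n <= balanced_level rho n0.-1 E)%N.
    by rewrite -(ler_nat R); exact: le_trans EL.
  apply: le_trans (hB _ nL) _; rewrite -[leLHS]mulrA -[leRHS]mulrA ler_wpM2l //.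
  have -> : `|ln eps| = E by rewrite -normrN ger0_norm // (le_trans ler01).
  have -> : eps `^ (- rho) = expR (rho * E).
    by rewrite /powR gt_eqF // mulNr -mulrN.
  by rewrite -(natrB R n0_gt0) subn1.
Qed.
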